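(* Every poset matrix $A\in\mathcal{PM}(n)$ is an induced principal submatrix of the binary Pascal matrix $\mathbf{P}_{2^n}$. More precisely, there exists an index set $\alpha=(\alpha_0,\ldots,\alpha_{n-1})\in Q_{n,2^n}$ with $2^i\le\alpha_i<2^{i+1}$ for all $i\in\{0,\ldots,n-1\}$ such that $A=\mathbf{P}_{2^n}[\alpha]$, where $\alpha$ is determined by $$A(2^0,2^1,\ldots,2^{n-1})^T=(\alpha_0,\ldots,\alpha_{n-1})^T$$ (the matrix-vector product being computed over the integers).
   Context: Let $X_n=\{0,1,\ldots,n-1\}$. $\mathcal{PM}(n)$ denotes the set of $n\times n$ $(0,1)$-matrices $A=[a_{ij}]_{0\le i,j\le n-1}$ that are lower triangular with all diagonal entries $1$ and transitive ($a_{ij}=1$ and $a_{jk}=1$ imply $a_{ik}=1$); these are the poset matrices ($a_{ij}=1$ iff $j\preceq i$) of partial orders $\preceq$ on $X_n$ for which $x\preceq y$ implies $x\le y$. The binary Pascal matrix $\mathbf{P}_m$ is the $m\times m$ $(0,1)$-matrix with $(\mathbf{P}_m)_{i,j}\equiv\binom{i}{j}\pmod 2$ for $0\le i,j\le m-1$. $Q_{k,m}$ is the collection of $k$-element subsets of $X_m$, also written as vectors $(\alpha_0,\ldots,\alpha_{k-1})$. $M[\alpha]$ denotes the submatrix of $M$ with rows and columns indexed by $\alpha$, i.e. $(M[\alpha])_{i,j}=M_{\alpha_i,\alpha_j}$. *)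

(* Defs.v *)
From mathcomp Require Import all_boot all_order all_algebra.

Set Implicit Arguments.
Unset Strict Implicit.
Unset Printing Implicit Defensive.

Import GRing.Theory.
Local Open Scope ring_scope.

(* A poset matrix has [A i j = 1] iff j precedes i in the partial order.
   [is_trig_mx A] says that A is lower triangular. *)
Definition PM (n : nat) (A : 'M[int]_n) : Prop :=
  [/\ forall i j, A i j = 0 \/ A i j = 1,
      is_trig_mx A,
      forall i, A i i = 1
    & forall i j k, A i j = 1 -> A j k = 1 -> A i k = 1].

Definition binary_pascal (m : nat) : 'M[int]_m :=
  \matrix_(i < m, j < m) ('C(i, j) %% 2)%N%:Z.

(* A k-element subset of {0, ..., m-1} is represented by the vector that lists
   its elements in increasing order. *)
Definition Q (k m : nat) : {set k.-tuple 'I_m} :=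
  [set alpha : k.-tuple 'I_m | sorted ltn (map val alpha)].

Definition principal_submx (R : Type) (k m : nat) (M : 'M[R]_m)
    (alpha : k.-tuple 'I_m) : 'M[R]_k :=
  mxsub (tnth alpha) (tnth alpha) M.

(* Main.v *)
(* By Lucas' theorem modulo 2, the binomial coefficient C(a, b) is odd exactly
   when every binary digit of b is at most that of a. Reading row i of A as the
   binary expansion of alpha_i, transitivity and reflexivity say that
   A i j = 1 iff row j is contained in row i, i.e. iff C(alpha_i, alpha_j) is
   odd. The unit diagonal and triangularity put the leading digit of alpha_i
   in position i. *)

Require Import Defs.
From mathcomp Require Import all_boot all_order all_algebra.

Import GRing.Theory.
Local Open Scope ring_scope.

(** Pascal's rule takes row [2m+1] to row [2m+2], where the two terms of an odd column have equal
    parity and cancel; in the step to row [2m+3] one of the two terms is therefore always even. *)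
Lemma odd_bin_double (m k : nat) :
  [/\ odd 'C(m.*2, k.*2) = odd 'C(m, k),
      odd 'C(m.*2, k.*2.+1) = false,
      odd 'C(m.*2.+1, k.*2) = odd 'C(m, k)
    & odd 'C(m.*2.+1, k.*2.+1) = odd 'C(m, k)].
Proof.
elim: m k => [|m IHm] k; first by case: k => [|[|k]].
have even_even l : odd 'C(m.+1.*2, l.*2) = odd 'C(m.+1, l).
  case: l => [|l]; first by rewrite !bin0.
  rewrite !doubleS binS oddD -doubleS (binS m) oddD.
  have [_ _ -> _] := IHm l.+1; have [_ _ _ ->] := IHm l.
  by [].
have even_odd l : odd 'C(m.+1.*2, l.*2.+1) = false.
  rewrite doubleS binS oddD.
  by have [_ _ -> ->] := IHm l; rewrite addbb.
split=> //; last by rewrite binS oddD even_even even_odd.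
case: k => [|k]; first by rewrite !bin0.
by rewrite (doubleS k) binS oddD -(doubleS k) even_even even_odd addbF.
Qed.

Lemma odd_bin_digit (a b : bool) (m k : nat) :
  odd 'C(a + m.*2, b + k.*2) = (b ==> a) && odd 'C(m, k).
Proof. by have [] := odd_bin_double m k; case: a; case: b. Qed.

Lemma odd_bin_digits (n : nat) (f g : 'I_n -> bool) :
  odd 'C(\sum_(i < n) f i * 2 ^ i, \sum_(i < n) g i * 2 ^ i)
    = [forall i, g i ==> f i].
Proof.
(* [big_andE] turns the premise [g i] into a filter; [big_mkcond] moves it back inside a conjunction
   over all [i], from which digit 0 can be split off. *)
rewrite -big_andE [RHS]big_mkcond.
elim: n f g => [|n IHn] f g; first by rewrite !big_ord0.
have low_digit (h : 'I_n.+1 -> bool) :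
  (\sum_(i < n.+1) h i * 2 ^ i
     = h ord0 + (\sum_(i < n) h (lift ord0 i) * 2 ^ i).*2)%N.
  rewrite big_ord_recl muln1 -muln2 big_distrl; congr addn.
  by apply: eq_bigr => i _; rewrite /= -mulnA -expnSr.
by rewrite !low_digit odd_bin_digit IHn big_ord_recl.
Qed.

(** Distinct powers of 2 below [2 ^ k] sum to at most [2 ^ k - 1]. Since [k] is independent of [n],
    this serves both for [k = i + 1] on row [i] and for [k = n]. *)
Lemma digits_lt (n k : nat) (f : 'I_n -> bool) :
  (forall i, f i -> (i < k)%N) -> (\sum_(i < n) f i * 2 ^ i < 2 ^ k)%N.
Proof.
move=> f_lt.
have -> : (2 ^ k = (\sum_(i < k) 2 ^ i).+1)%N.
  by rewrite -[LHS]prednK ?expn_gt0 // predn_exp mul1n.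
rewrite ltnS; have [le_kn|lt_nk] := leqP k n.
  rewrite (big_ord_widen n (fun i => 2 ^ i)%N le_kn) [leqRHS]big_mkcond.
  apply: leq_sum => i _; move: (f_lt i).
  by case: (f i) => [->|_]; rewrite ?mul1n.
apply: (@leq_trans (\sum_(i < n) 2 ^ i)%N).
  by apply: leq_sum => i _; case: (f i); rewrite ?mul1n.
rewrite (big_ord_widen k (fun i => 2 ^ i)%N (ltnW lt_nk)) [leqLHS]big_mkcond.
by apply: leq_sum => i _; case: ifP.
Qed.

Theorem theorem3p1 (n : nat) (A : 'M[int]_n) (hA : PM A) :
  exists alpha : n.-tuple 'I_(2 ^ n)%N,
    [/\ alpha \in Q n (2 ^ n)%N,
        forall i : 'I_n, (2 ^ i <= tnth alpha i < 2 ^ i.+1)%N,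
        A = principal_submx (binary_pascal (2 ^ n)%N) alpha
      & A *m (\col_(i < n) (2 ^ i)%N%:Z) = \col_(i < n) (tnth alpha i : nat)%:Z].
Proof.
have [A01 /is_trig_mxP A_trig A_diag A_trans] := hA.
pose f i j := A i j == 1.
have AE i j : A i j = (f i j)%:Z by rewrite /f; case: (A01 i j) => ->.
pose a i := (\sum_(j < n) f i j * 2 ^ j)%N.
have a_lt i : (a i < 2 ^ i.+1)%N.
  apply: digits_lt => j; rewrite ltnS leqNgt; apply: contraL => lt_ij.
  by rewrite /f A_trig.
have a_ge (i : 'I_n) : (2 ^ i <= a i)%N.
  by rewrite /a (bigD1 i) //= /f A_diag eqxx mul1n leq_addr.
have a_bound i : (a i < 2 ^ n)%N by apply: digits_lt.
pose alpha := [tuple Ordinal (a_bound i) | i < n].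
have alphaE i : tnth alpha i = a i :> nat by rewrite tnth_mktuple.
exists alpha; split.
- rewrite inE sorted_pairwise; last exact: ltn_trans.
  apply/(pairwiseP 0%N) => i j.
  rewrite !inE size_map size_tuple => lt_in lt_jn lt_ij.
  rewrite !(nth_map (Ordinal (a_bound (Ordinal lt_in)))) ?size_tuple //.
  rewrite -(tnth_nth _ _ (Ordinal lt_in)) -(tnth_nth _ _ (Ordinal lt_jn)).
  (* For [i < j]: [a i < 2 ^ i.+1 <= 2 ^ j <= a j]. *)
  rewrite /= !alphaE; apply: leq_trans (a_lt _) (leq_trans _ (a_ge _)).
  by rewrite leq_exp2l.
- by move=> i; rewrite alphaE a_ge a_lt.
- apply/matrixP => i j; rewrite !mxE !alphaE modn2 odd_bin_digits AE.
  congr ((nat_of_bool _)%:Z); apply/idP/forallP => [/eqP Aij k|].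
    by apply/implyP => /eqP Ajk; apply/eqP/(A_trans _ _ _ Aij Ajk).
  (* Containment of row [j] in row [i] is only needed at column [j], where row [j] has its diagonal
     1. *)
  by move/(_ j)/implyP; apply; rewrite /f A_diag.
- apply/matrixP => i j; rewrite !mxE alphaE -natz natr_sum.
  by apply: eq_bigr => k _; rewrite mxE AE natrM !natz.
Qed.
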